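(* For every $r\in\{1,2,3,4,5,6,7\}$ there exists a unitary matrix $U$ on $\mathbb{C}^2\otimes\mathbb{C}^2\otimes\mathbb{C}^2$ with $\mathrm{sr}(U)=r$.
   Context: For a matrix $U$ on $\mathbb{C}^2\otimes\mathbb{C}^2\otimes\mathbb{C}^2$ (systems $A,B,C$), its Schmidt rank $\mathrm{sr}(U)$ is the least integer $r$ such that $U=\sum_{j=1}^r A_j\otimes B_j\otimes C_j$ with $A_j,B_j,C_j$ complex $2\times 2$ matrices (i.e. the tensor rank of $U$). *)

(* Defs.v *)
From HB Require Import structures.
From mathcomp Require Import all_boot all_order all_algebra.
From mathcomp Require Import reals.
From mathcomp Require Import complex mxtens.
Set Implicit Arguments. Unset Strict Implicit. Unset Printing Implicit Defensive.
Import Order.TTheory GRing.Theory Num.Theory.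
Local Open Scope ring_scope.
Local Open Scope complex_scope.

(* Operators on C^2 (x) C^2 (x) C^2 = C^8, indices ordered as in tensmx (A *t (B *t C)). *)
Notation op3 R := 'M[R[i]]_(2 * (2 * 2)).

Definition adjmx (R : realType) (m n : nat) (M : 'M[R[i]]_(m, n)) : 'M[R[i]]_(n, m) :=
  (map_mx conjc M)^T.

Definition unitary (R : realType) (U : op3 R) : Prop :=
  U *m adjmx U = 1%:M /\ adjmx U *m U = 1%:M.

Definition has_tensor_decomp (R : realType) (U : op3 R) (r : nat) : Prop :=
  exists (A B C : 'I_r -> 'M[R[i]]_2),
    U = \sum_(j < r) (A j *t (B j *t C j)).

Definition schmidt_rank_eq (R : realType) (U : op3 R) (r : nat) : Prop :=
  has_tensor_decomp U r /\ forall k, (k < r)%N -> ~ has_tensor_decomp U k.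

(* Main.v *)
Require Import Defs.
From HB Require Import structures.
From mathcomp Require Import all_boot all_order all_algebra.
From mathcomp Require Import reals.
From mathcomp Require Import complex mxtens.
From mathcomp Require Import ring.

(** Regard an operator as a trilinear form on pairs of indices; fixing the first
argument gives a space of 4x4 matrices (slices), and a decomposition into [k]
product terms writes all slices as [B^T diag(.) C] with [k] rows.

For [r <= 4] one slice of rank [r] suffices. For [r = 5, 6] we use controlled
operators [P0 (x) SWAP + P1 (x) V], whose two slices [S], [V] form a pencil such
that [S^-1 V] has [r - 4] nilpotent Jordan blocks of size two; each of them
costs one extra term.

For [r = 7] the cyclic shift of the three qubits is the tensor [tr (X Y Z)] of
2x2 matrix multiplication, and Strassen's identity gives seven terms. If there
were six, pick four independent functionals [a_1 .. a_4] on [X] with dual basis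
[X_1 .. X_4]. A matrix [X] killed by three functionals has a slice of rank at
most 3, hence is singular. So the [X_i] are isotropic for the determinant form,
and so is the span of those on which a fifth functional does not vanish; being
totally isotropic, this span has dimension at most 2. The two leftover
functionals therefore split the basis into two pairs, and the members of one
pair share a fifth term [b_5 c_5], which fixes both their row and their column
space: they are proportional, a contradiction. *)

Set Implicit Arguments.
Unset Strict Implicit.
Unset Printing Implicit Defensive.
Import Order.TTheory GRing.Theory Num.Theory.
Local Open Scope ring_scope.
Local Open Scope complex_scope.

(* If [k < n + m], some nonzero [x] has [x C^T] supported on [m] indices on which
   [W B^T] is invertible. Then [W V = 0] forces [x V^T = 0], so [W S = D V]
   forces [x S^T = 0] and [x = 0]. *)
Lemma pencil_rank_lower_bound (F : fieldType) (p n m k : nat)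
    (S V : 'M[F]_(p, n)) (B : 'M_(k, p)) (C : 'M_(k, n)) (s v : 'rV_k)
    (P : 'M_(n, p)) (W : 'M_(m, p)) (D : 'M_(m, p)) (d : F) :
  d != 0 ->
  S = B^T *m diag_mx s *m C -> V = B^T *m diag_mx v *m C ->
  P *m S = d%:M -> row_free (W *m S) -> W *m V = 0 -> W *m S = D *m V ->
  (n + m <= k)%N.
Proof.
move=> d0 defS defV PS freeWS WV0 WSDV; rewrite leqNgt; apply/negP => ltk.
set G := W *m B^T.
have fullGt : row_full G^T.
  rewrite -col_leq_rank mxrank_tr -{1}(eqP freeWS) defS !mulmxA -/G -mulmxA.
  exact: mxrankM_maxl.
pose f := fullrankfun fullGt; pose E : 'M[F]_(m, k) := rowsub f 1%:M.
have GJ : E *m G^T \in unitmx by rewrite mul_rowsub_mx mul1mx fullrowsub_unit.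
have freeE : row_free E.
  rewrite -row_leq_rank -{1}(mxrank_unit GJ); exact: mxrankM_maxl.
have diagE (e : 'rV[F]_k) : E *m diag_mx e = diag_mx (\row_i e 0 (f i)) *m E.
  apply/matrixP => i j; rewrite mul_mx_diag mul_diag_mx !mxE.
  by rewrite mulrC; case: eqP => [->|_]; rewrite ?mulr0.
have killE (e : 'rV[F]_k) (h : 'rV[F]_m) : h *m E *m diag_mx e *m G^T = 0 ->
    h *m E *m diag_mx e = 0.
  rewrite -(mulmxA h) diagE !mulmxA -[_ *m E *m _]mulmxA => /eqP.
  by rewrite mulmx_free_eq0 ?row_free_unit // => /eqP ->; rewrite mul0mx.
(* The stacked matrix has [n + m] rows but only [k] columns, so its rows satisfy a linear relation,
   whose two blocks are [x] and [h]. *)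
have : kermx (col_mx C^T E) != 0.
  rewrite kermx_eq0 -row_leq_rank -ltnNge.
  exact: leq_ltn_trans (rank_leq_col _) ltk.
case/rowV0Pn => z /sub_kermxP; rewrite -[z]hsubmxK mul_row_col.
set x := lsubmx z; set h := rsubmx z => xCh0 z0.
have xC : x *m C^T = - h *m E.
  by apply/eqP; rewrite mulNmx -addr_eq0 xCh0.
have xSt : x *m S^T = - h *m E *m diag_mx s *m B.
  by rewrite defS !trmx_mul trmxK tr_diag_mx !mulmxA xC.
have xVt : x *m V^T = - h *m E *m diag_mx v *m B.
  by rewrite defV !trmx_mul trmxK tr_diag_mx !mulmxA xC.
have GtE : G^T = B *m W^T by rewrite trmx_mul trmxK.
have xV0 : x *m V^T = 0.
  rewrite xVt killE ?mul0mx // GtE mulmxA -xVt -mulmxA -trmx_mul WV0.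
  by rewrite trmx0 mulmx0.
have xS0 : x *m S^T = 0.
  rewrite xSt killE ?mul0mx // GtE mulmxA -xSt -mulmxA -trmx_mul WSDV.
  by rewrite trmx_mul mulmxA xV0 mul0mx.
have x0 : x = 0.
  apply: (scalerI d0); rewrite scaler0 -mul_mx_scalar -tr_scalar_mx -PS.
  by rewrite trmx_mul mulmxA xS0 mul0mx.
move: xCh0 z0; rewrite x0 mul0mx add0r => /eqP.
by rewrite mulmx_free_eq0 // => /eqP ->; rewrite row_mx0 eqxx.
Qed.

(** * Integer matrices whose identities are decided by computation *)

Section IntegerMatrices.

Variable F : comNzRingType.

Definition intmx (m n : nat) (f : nat -> nat -> int) : 'M[F]_(m, n) :=
  \matrix_(i, j) (f i j)%:~R.

(* Computable by [vm_compute], unlike the locked [\sum]. *)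
Definition intsum (n : nat) (f : nat -> int) : int :=
  foldr (fun k z => f k + z) 0 (iota 0 n).

Lemma intsumE n f : intsum n f = \sum_(k < n) f k.
Proof.
by rewrite -(big_mkord predT f) /index_iota subn0 /intsum unlock /=.
Qed.

Definition mulint (n : nat) (f g : nat -> nat -> int) (i j : nat) : int :=
  intsum n (fun k => f i k * g k j).

Definition inteq (m n : nat) (f g : nat -> nat -> int) : bool :=
  all (fun i => all (fun j => f i j == g i j) (iota 0 n)) (iota 0 m).

Definition intscalar (d : int) (i j : nat) : int := if i == j then d else 0.

(** Missing entries read as zero, so [[::]] can stand for an empty matrix. *)
Definition introws (s : seq (seq int)) (i j : nat) : int := (nth [::] s i)`_j.

Lemma intmx_mul m n p f g :
  intmx m n f *m intmx n p g = intmx m p (mulint n f g).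
Proof.
apply/matrixP => i j; rewrite !mxE /mulint intsumE rmorph_sum /=.
by apply: eq_bigr => k _; rewrite !mxE intrM.
Qed.

Lemma intmx_eq m n f g : inteq m n f g -> intmx m n f = intmx m n g.
Proof.
move=> /allP eqfg; apply/matrixP => i j; rewrite !mxE.
have /allP/(_ (val j)) := eqfg (val i) ltac:(by rewrite mem_iota /=).
by rewrite mem_iota /= => /(_ (ltn_ord j))/eqP ->.
Qed.

Lemma intmx_scalar n d : intmx n n (intscalar d) = d%:~R%:M.
Proof. by apply/matrixP => i j; rewrite !mxE /intscalar val_eqE; case: eqP. Qed.

Lemma intmx_mul_eq m n p f g h :
  inteq m p (mulint n f g) h -> intmx m n f *m intmx n p g = intmx m p h.
Proof. by rewrite intmx_mul; apply: intmx_eq. Qed.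

End IntegerMatrices.

(** * Operators given by integer tensors, their slices and rank certificates *)

Section IntegerTensors.

Variable R : realType.
Local Notation C := R[i].

Definition int_tensor := seq (seq int * seq int * seq int).

Definition mx2 (z : seq int) : 'M[C]_2 := intmx C 2 2 (fun i j => z`_(i * 2 + j)).

Definition tensor_op (l : int_tensor) : op3 R :=
  \sum_(j < size l) let t := nth ([::], [::], [::]) l j in
    mx2 t.1.1 *t (mx2 t.1.2 *t mx2 t.2).

Definition tensor_coef (l : int_tensor) (p q s : nat) : int :=
  foldr (fun t z => t.1.1`_p * t.1.2`_q * t.2`_s + z) 0 l.

(** Each of [i] and [j] has three binary digits, one per qubit; every factor is read at its own row
    and column digit. *)
Definition tensor_entry (l : int_tensor) (i j : nat) : int :=
  tensor_coef l (i %/ 4 * 2 + j %/ 4) ((i %% 4) %/ 2 * 2 + (j %% 4) %/ 2)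
    ((i %% 4) %% 2 * 2 + (j %% 4) %% 2).

Lemma tensor_opE l : tensor_op l = intmx C _ _ (tensor_entry l).
Proof.
rewrite /tensor_op -(big_mkord predT
  (fun j => let t := nth ([::], [::], [::]) l j in
    mx2 t.1.1 *t (mx2 t.1.2 *t mx2 t.2))).
rewrite -(big_nth _ predT (fun t => mx2 t.1.1 *t (mx2 t.1.2 *t mx2 t.2))).
apply/matrixP => i j; rewrite summxE !mxE /tensor_entry.
elim: l => [|t l IH]; first by rewrite big_nil.
by rewrite big_cons IH /= rmorphD /= !rmorphM /= !mxE /= mulrA.
Qed.

(** The first factor is paired with [X] without conjugation; rows then run over the entries of the
    second factor and columns over those of the third. *)
Definition slice (X : 'M[C]_2) (U : op3 R) : 'M[C]_(2 * 2) :=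
  \matrix_(q, s) \sum_i \sum_j X i j *
    U (mxtens_index (i, mxtens_index ((mxtens_unindex q).1, (mxtens_unindex s).1)))
      (mxtens_index (j, mxtens_index ((mxtens_unindex q).2, (mxtens_unindex s).2))).

Definition dotmx (X A : 'M[C]_2) : C := \sum_i \sum_j X i j * A i j.

Definition rowvecs (k : nat) (B : 'I_k -> 'M[C]_2) : 'M[C]_(k, 2 * 2) :=
  \matrix_(j, q) B j (mxtens_unindex q).1 (mxtens_unindex q).2.

(** The regrouping of indices turns each product term into a matrix of rank at most one, weighted by
    the pairing of its first factor with [X]. *)
Lemma slice_decomp k (A B D : 'I_k -> 'M[C]_2) X :
  slice X (\sum_(j < k) (A j *t (B j *t D j))) =
  (rowvecs B)^T *m diag_mx (\row_j dotmx X (A j)) *m rowvecs D.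
Proof.
apply/matrixP => q s; rewrite mul_mx_diag !mxE.
under eq_bigr => i _ do under eq_bigr => j _ do
  rewrite summxE mulr_sumr.
under eq_bigr => i _ do rewrite exchange_big /=.
rewrite exchange_big /=; apply: eq_bigr => h _.
rewrite !mxE /dotmx !(mulr_suml, mulr_sumr); apply: eq_bigr => i _.
rewrite !(mulr_suml, mulr_sumr); apply: eq_bigr => j _.
by rewrite !tensmxE; ring.
Qed.

Lemma slice_tensor_opE l X q s : slice X (tensor_op l) q s =
  \sum_i \sum_j X i j * (tensor_coef l (i * 2 + j) q s)%:~R.
Proof.
have indexE (a b c : nat) : (b < 2)%N -> (c < 2)%N ->
    [/\ ((a * (2 * 2) + (b * 2 + c)) %/ 4 = a)%N,
        (((a * (2 * 2) + (b * 2 + c)) %% 4) %/ 2 = b)%N &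
        (((a * (2 * 2) + (b * 2 + c)) %% 4) %% 2 = c)%N].
  move=> hb hc; rewrite divnMDl // modnMDl.
  by move: b c hb hc => [|[|b]] // [|[|c]] // _ _; split; rewrite ?addn0.
rewrite tensor_opE !mxE; apply: eq_bigr => i _; apply: eq_bigr => j _.
rewrite mxE /tensor_entry /=.
have q2 : (q %/ 2 < 2)%N by rewrite ltn_divLR.
have s2 : (s %/ 2 < 2)%N by rewrite ltn_divLR.
have q1 : (q %% 2 < 2)%N by rewrite ltn_mod.
have s1 : (s %% 2 < 2)%N by rewrite ltn_mod.
have [-> -> ->] := indexE i _ _ q2 s2; have [-> -> ->] := indexE j _ _ q1 s1.
by rewrite -!divn_eq.
Qed.

Definition slice_entry (l : int_tensor) (x : seq int) (q s : nat) : int :=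
  intsum 2 (fun i => intsum 2 (fun j => x`_(i * 2 + j) * tensor_coef l (i * 2 + j) q s)).

Lemma slice_tensor_op l x :
  slice (mx2 x) (tensor_op l) = intmx C _ _ (slice_entry l x).
Proof.
apply/matrixP => q s; rewrite slice_tensor_opE !mxE /slice_entry intsumE rmorph_sum.
apply: eq_bigr => i _; rewrite intsumE rmorph_sum; apply: eq_bigr => j _.
by rewrite mxE rmorphM.
Qed.

Lemma tensor_op_decomp l : has_tensor_decomp (tensor_op l) (size l).
Proof.
pose t (j : 'I_(size l)) := nth ([::], [::], [::]) l j.
by exists (fun j => mx2 (t j).1.1), (fun j => mx2 (t j).1.2), (fun j => mx2 (t j).2).
Qed.

Lemma has_tensor_decompS (U : op3 R) k :
  has_tensor_decomp U k -> has_tensor_decomp U k.+1.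
Proof.
case=> A [B [D ->]].
pose e (f : 'I_k -> 'M[C]_2) (j : 'I_k.+1) := oapp f 0 (unlift ord0 j).
exists (e A), (e B), (e D).
rewrite big_ord_recl /e unlift_none /= tens0mx add0r.
by apply: eq_bigr => j _; rewrite liftK.
Qed.

Lemma has_tensor_decomp_le (U : op3 R) k m :
  (k <= m)%N -> has_tensor_decomp U k -> has_tensor_decomp U m.
Proof.
by move=> /subnK <-; elim: (m - k)%N => // h IH /IH /has_tensor_decompS.
Qed.

(** Conjugation fixes integers, so the adjoint is the transpose and unitarity is an identity between
    integer matrices. *)
Lemma tensor_op_unitary l :
  inteq 8 8 (mulint 8 (tensor_entry l) (fun i j => tensor_entry l j i)) (intscalar 1) ->
  unitary (tensor_op l).
Proof.
move=> chk.
have UU : tensor_op l *m adjmx (tensor_op l) = 1%:M.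
  have -> : adjmx (tensor_op l) = intmx C _ _ (fun i j => tensor_entry l j i).
    by apply/matrixP => i j; rewrite tensor_opE !mxE rmorph_int.
  by rewrite tensor_opE -[1]/(1%:~R) -intmx_scalar; apply: intmx_mul_eq.
by split=> //; apply: mulmx1C.
Qed.

(* The pencil bound, applied to the slices of [tensor_op l] along [x] and [y]
   restricted to the columns of [Q]; [L] witnesses that [W S] is row free. *)
Definition pencil_check (l : int_tensor) (n m : nat) (x y : seq int)
    (P Q W D L : seq (seq int)) (d : int) : bool :=
  let S := mulint 4 (slice_entry l x) (introws Q) in
  let V := mulint 4 (slice_entry l y) (introws Q) in
  let WS := mulint 4 (introws W) S in
  [&& d != 0, inteq n n (mulint 4 (introws P) S) (intscalar d),
      inteq m m (mulint n WS (introws L)) (intscalar d),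
      inteq m n (mulint 4 (introws W) V) (fun _ _ => 0) &
      inteq m n WS (mulint 4 (introws D) V)].

(** [P] and [L] are one-sided inverses up to the factor [d], which keeps the certificate integral.
    For [m = 0] this is the plain bound by the rank of one slice. *)
Lemma pencil_checkP l n m x y P Q W D L d k :
  pencil_check l n m x y P Q W D L d ->
  has_tensor_decomp (tensor_op l) k -> (n + m <= k)%N.
Proof.
case/and5P => d0 chkP chkL chkV chkD [A [B [D' def]]].
pose MQ := intmx C (2 * 2) n (introws Q).
pose MW := intmx C m (2 * 2) (introws W).
pose ML := intmx C n m (introws L).
have d0' : d%:~R != 0 :> C by rewrite intr_eq0.
have sliceE z : slice (mx2 z) (tensor_op l) *m MQ = 
    intmx C (2 * 2) n (mulint 4 (slice_entry l z) (introws Q)).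
  by rewrite slice_tensor_op intmx_mul.
apply: (@pencil_rank_lower_bound C (2 * 2) n m k
  (slice (mx2 x) (tensor_op l) *m MQ) (slice (mx2 y) (tensor_op l) *m MQ)
  (rowvecs B) (rowvecs D' *m MQ)
  (\row_j dotmx (mx2 x) (A j)) (\row_j dotmx (mx2 y) (A j))
  (intmx C n (2 * 2) (introws P)) MW (intmx C m (2 * 2) (introws D)) d%:~R).
- by [].
- by rewrite def slice_decomp !mulmxA.
- by rewrite def slice_decomp !mulmxA.
- by rewrite sliceE -intmx_scalar; apply: intmx_mul_eq.
- apply/row_freeP; exists (d%:~R^-1 *: ML).
  apply: (scalerI d0'); rewrite -scalemxAr scalerA divff // scale1r scalemx1.
  by rewrite sliceE intmx_mul -intmx_scalar; apply: intmx_mul_eq.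
- rewrite sliceE (intmx_mul_eq _ chkV).
  by apply/matrixP => i j; rewrite !mxE.
- by rewrite !sliceE !intmx_mul; apply: intmx_eq.
Qed.

End IntegerTensors.

(** * Sums of rank one terms restricted to the nonzero weights *)

Section DiagonalSupport.

Variables (F : fieldType) (k m n : nat).
Implicit Types (B : 'M[F]_(k, m)) (C : 'M[F]_(k, n)) (c : 'rV[F]_k).

Definition diag_support c : {set 'I_k} := [set j | c 0 j != 0].

Lemma diag_decomp_support B C c (K := diag_support c) :
  B^T *m diag_mx c *m C =
  (rowsub (@enum_val _ (mem K)) B)^T *m
    (diag_mx (\row_j c 0 (@enum_val _ (mem K) j)) *m rowsub (@enum_val _ (mem K)) C).
Proof.
apply/matrixP => q s; rewrite mulmxA !mul_mx_diag !mxE.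
rewrite (bigID (mem K)) /= [X in _ + X]big1 ?addr0 => [|j]; last first.
  by rewrite inE negbK !mxE => /eqP ->; rewrite mulr0 mul0r.
rewrite big_enum_val /=; apply: eq_bigr => j _.
by rewrite !mxE.
Qed.

Lemma rank_diag_decomp B C c : (\rank (B^T *m diag_mx c *m C) <= #|diag_support c|)%N.
Proof.
rewrite diag_decomp_support.
by apply: leq_trans (mxrankM_maxl _ _) _; rewrite mxrank_tr rank_leq_row.
Qed.

Lemma row_free_row_neq0 p q (A : 'M[F]_(p, q)) i : row_free A -> row i A != 0.
Proof.
move=> freeA; rewrite rowE mulmx_free_eq0 //; apply/eqP => /rowP/(_ i).
by rewrite !mxE !eqxx => /eqP; rewrite oner_eq0.
Qed.

(** When the active terms are no more than the rank, the active rows of [C] are independent, and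
    their span, which contains the row space of [N], equals it by dimension. *)
Lemma tight_decomp_row B C c j (N := B^T *m diag_mx c *m C) :
  (#|diag_support c| <= \rank N)%N -> c 0 j != 0 -> row j C != 0 /\ (row j C <= N)%MS.
Proof.
rewrite /N diag_decomp_support; set K := diag_support c.
set Bk := rowsub _ B; set Ck := rowsub _ C; set D := diag_mx _.
move=> rkN cj.
have jK : j \in K by rewrite inE.
have sub : (Bk^T *m (D *m Ck) <= Ck)%MS by rewrite mulmxA submxMl.
have freeC : row_free Ck.
  by rewrite -row_leq_rank (leq_trans rkN) // mxrankS.
have rowC : row (enum_rank_in jK j) Ck = row j C.
  by apply/rowP => s; rewrite !mxE enum_rankK_in.
split; first by rewrite -rowC row_free_row_neq0.
rewrite -rowC; apply: submx_trans (row_sub _ _) _.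
by rewrite -(mxrank_leqif_sup sub) eqn_leq mxrankS //= (leq_trans (rank_leq_row _)).
Qed.

End DiagonalSupport.

(** * The 2x2 matrix multiplication tensor has rank greater than six *)

Section MatrixMultiplicationRank.

Variable F : fieldType.
Implicit Types (x y z b c : 'rV[F]_4).

Local Notation o0 := (@Ordinal 4 0 isT).
Local Notation o1 := (@Ordinal 4 1 isT).
Local Notation o2 := (@Ordinal 4 2 isT).
Local Notation o3 := (@Ordinal 4 3 isT).

(* The matrix of [(Y, Z) |-> \tr (X *m Y *m Z)], with [x], [Y], [Z] listed in
   row-major order. *)
Definition mulslice x : 'M[F]_4 :=
  \matrix_(q, s) if (q %% 2 == s %/ 2)%N then x 0 (inord (s %% 2 * 2 + q %/ 2))
                 else 0.

Definition det4 x : F := x 0 o0 * x 0 o3 - x 0 o1 * x 0 o2.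

(** The Gram matrix of the bilinear form polar to [det4]. *)
Definition polar4 : 'M[F]_4 :=
  \matrix_(i, j) if (i + j == 3)%N then
    (if (i == 0%N :> nat) || (i == 3%N :> nat) then 1 else -1) else 0.

Lemma ord4P (P : 'I_4 -> Prop) : P o0 -> P o1 -> P o2 -> P o3 -> forall i, P i.
Proof.
move=> P0 P1 P2 P3 [[|[|[|[|i]]]] lti] //.
- by rewrite (_ : Ordinal lti = o0) //; apply: val_inj.
- by rewrite (_ : Ordinal lti = o1) //; apply: val_inj.
- by rewrite (_ : Ordinal lti = o2) //; apply: val_inj.
- by rewrite (_ : Ordinal lti = o3) //; apply: val_inj.
Qed.

Lemma inord4 i (lti : (i < 4)%N) : inord i = Ordinal lti :> 'I_4.
Proof. by apply: val_inj; rewrite /= inordK. Qed.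

Definition inord4E := (@inord4 0 isT, @inord4 1 isT, @inord4 2 isT, @inord4 3 isT).

Lemma sum4 (f : 'I_4 -> F) : \sum_i f i = f o0 + f o1 + f o2 + f o3.
Proof.
rewrite !big_ord_recl big_ord0 addr0 !addrA.
by congr (f _ + f _ + f _ + f _); apply: val_inj.
Qed.

Lemma det4B (a b : F) x y : det4 x = 0 -> det4 y = 0 ->
  det4 (a *: x - b *: y) = - (a * b) * (x *m polar4 *m y^T) 0 0.
Proof.
rewrite !mxE sum4 !mxE !sum4 !mxE /= /det4 !mxE => hx hy.
transitivity (a ^+ 2 * (x 0 o0 * x 0 o3 - x 0 o1 * x 0 o2) +
 b ^+ 2 * (y 0 o0 * y 0 o3 - y 0 o1 * y 0 o2) -
 a * b * (x 0 o0 * y 0 o3 + x 0 o3 * y 0 o0 - x 0 o1 * y 0 o2 - x 0 o2 * y 0 o1)).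
  ring.
rewrite hx hy; ring.
Qed.

Lemma polar4_unit : polar4 \in unitmx.
Proof.
suff /mulmx1_unit[] : polar4 *m polar4 = 1%:M by [].
apply/matrixP => i j; rewrite !mxE sum4 !mxE.
by elim/ord4P: i; elim/ord4P: j => /=; rewrite ?(mulr0, mul0r, addr0, add0r,
  mulr1, mulrNN).
Qed.

(** Up to reordering of rows and columns, [mulslice x] consists of two diagonal copies of the
    transpose of the 2x2 matrix [x]; [M] holds the transposed adjugate in the matching blocks. *)
Lemma rank_mulslice_det x : det4 x != 0 -> \rank (mulslice x) = 4%N.
Proof.
move=> dx; apply: mxrank_unit.
pose M : 'M[F]_4 := \matrix_(s < 4, q < 4) if (q %% 2 == s %/ 2)%N then
  (if (s %% 2 == 0)%N then (if (q %/ 2 == 0)%N then x 0 o3 else - x 0 o2)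
   else (if (q %/ 2 == 0)%N then - x 0 o1 else x 0 o0)) else 0.
have E : mulslice x *m ((det4 x)^-1 *: M) = 1%:M.
  apply: (scalerI dx); rewrite -scalemxAr scalerA divff // scale1r scalemx1.
  apply/matrixP => i j; rewrite !mxE sum4 !mxE /=.
  by elim/ord4P: i; elim/ord4P: j => /=; rewrite ?inord4E /det4; ring.
by case/mulmx1_unit: E.
Qed.

(** A nonzero entry of [x] occurs in both diagonal copies, and the minor through these two places is
    scalar. *)
Lemma rank_mulslice_gt1 x : x != 0 -> (1 < \rank (mulslice x))%N.
Proof.
case/rV0Pn => t xt.
pose f (i : 'I_2) : 'I_4 := inord (t %% 2 * 2 + i).
pose g (i : 'I_2) : 'I_4 := inord (i * 2 + t %/ 2).
have : mxsub f g (mulslice x) = (x 0 t)%:M.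
  apply/matrixP => i j; rewrite !mxE /f /g.
  case: i j => [[|[|i]] ?] // [[|[|j]] ?] //; elim/ord4P: t xt {f g} => _ /=;
  by rewrite ?inord4E /= ?inord4E.
move=> E; have rk2 : \rank ((x 0 t)%:M : 'M[F]_2) = 2%N.
  by rewrite mxrank_unit // unitmxE det_scalar unitfE expf_neq0.
rewrite -[X in (X <= _)%N]rk2 -E -{1}[mulslice x]mulmx1 mxsub_mul.
rewrite (leq_trans (mxrankM_maxl _ _)) //.
by rewrite -{1}[mulslice x]mul1mx -mul_rowsub_mx mxrankM_maxr.
Qed.

(** The rows [(a, b)] and [(c, d)] are dependent, so their combination [(r, s)] is parallel to
    both. *)
Lemma kill_row (a b c d r s : F) (u v : F) :
  a * d = b * c -> r = u * a + v * c -> s = u * b + v * d ->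
  r * b = s * a /\ r * d = s * c.
Proof.
move=> E -> ->; split; apply/eqP; rewrite -subr_eq0; apply/eqP.
  transitivity (v * (b * c - a * d)); [ring | by rewrite E subrr mulr0].
transitivity (u * (a * d - b * c)); [ring | by rewrite E subrr mulr0].
Qed.

(* A nonzero row space and a nonzero column space pin down a matrix of
   rank one up to a scalar. *)
Lemma mulslice_line b c : b != 0 -> c != 0 ->
  exists z, forall x, det4 x = 0 -> (b <= (mulslice x)^T)%MS ->
    (c <= mulslice x)%MS -> exists a, x = a *: z.
Proof.
move=> b0 c0.
(* [(r, s)] is a common direction for the rows of the 2x2 matrix [x]. It is one of the two halves of
   [b], one half per diagonal copy, chosen nonzero. *)
have [r [s [rs Hb]]] : exists r s : F, (r != 0) || (s != 0) /\
   forall x, det4 x = 0 -> (b <= (mulslice x)^T)%MS ->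
   r * x 0 o1 = s * x 0 o0 /\ r * x 0 o3 = s * x 0 o2.
  have H x : det4 x = 0 -> (b <= (mulslice x)^T)%MS ->
    (b 0 o0 * x 0 o1 = b 0 o2 * x 0 o0 /\ b 0 o0 * x 0 o3 = b 0 o2 * x 0 o2) /\
    (b 0 o1 * x 0 o1 = b 0 o3 * x 0 o0 /\ b 0 o1 * x 0 o3 = b 0 o3 * x 0 o2).
    move=> /eqP; rewrite subr_eq0 => /eqP dx /submxP[u ->].
    rewrite !mxE !sum4 !mxE /= !inord4E !(mulr0, addr0, add0r).
    by split; apply: kill_row dx _ _; rewrite // addrC.
  case: (boolP ((b 0 o0 != 0) || (b 0 o2 != 0))) => h.
    by exists (b 0 o0), (b 0 o2); split=> // x dx /(H x dx)[].
  exists (b 0 o1), (b 0 o3); split=> [|x dx /(H x dx)[] //].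
  move: b0; rewrite -negb_and; apply: contraNN => /andP[/eqP b1 /eqP b3].
  move: h; rewrite negb_or !negbK => /andP[/eqP b0 /eqP b2].
  by apply/eqP/rowP; elim/ord4P; rewrite mxE.
have [t [v [tv Hc]]] : exists t v : F, (t != 0) || (v != 0) /\
   forall x, det4 x = 0 -> (c <= mulslice x)%MS ->
   t * x 0 o2 = v * x 0 o0 /\ t * x 0 o3 = v * x 0 o1.
  have H x : det4 x = 0 -> (c <= mulslice x)%MS ->
    (c 0 o0 * x 0 o2 = c 0 o1 * x 0 o0 /\ c 0 o0 * x 0 o3 = c 0 o1 * x 0 o1) /\
    (c 0 o2 * x 0 o2 = c 0 o3 * x 0 o0 /\ c 0 o2 * x 0 o3 = c 0 o3 * x 0 o1).
    move=> /eqP; rewrite subr_eq0 [_ 0 o1 * _]mulrC => /eqP dx /submxP[u ->].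
    rewrite !mxE !sum4 !mxE /= !inord4E !(mulr0, addr0, add0r).
    by split; apply: kill_row dx _ _; rewrite // addrC.
  case: (boolP ((c 0 o0 != 0) || (c 0 o1 != 0))) => h.
    by exists (c 0 o0), (c 0 o1); split=> // x dx /(H x dx)[].
  exists (c 0 o2), (c 0 o3); split=> [|x dx /(H x dx)[] //].
  move: c0; rewrite -negb_and; apply: contraNN => /andP[/eqP c2 /eqP c3].
  move: h; rewrite negb_or !negbK => /andP[/eqP c0 /eqP c1].
  by apply/eqP/rowP; elim/ord4P; rewrite mxE.
(* The outer product of the column direction [(t, v)] and the row direction [(r, s)], in row-major
   order. *)
exists (\row_i [:: r * t; s * t; r * v; s * v]`_i) => x dx hb hc.
have [e1 e2] := Hb x dx hb; have [e3 e4] := Hc x dx hc.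
have sol (p q y : F) : p != 0 -> p * y = q -> y = q / p.
  by move=> p0 <-; rewrite mulrC mulKf.
case/orP: rs => r0; case/orP: tv => t0.
- exists (x 0 o0 / (r * t)); apply/rowP; elim/ord4P; rewrite !mxE /=.
  + by field; apply/andP.
  + by rewrite (sol _ _ _ r0 e1); field; apply/andP.
  + by rewrite (sol _ _ _ t0 e3); field; apply/andP.
  + by rewrite (sol _ _ _ r0 e2) (sol _ _ _ t0 e3); field; apply/andP.
- exists (x 0 o2 / (r * v)); apply/rowP; elim/ord4P; rewrite !mxE /=.
  + by rewrite (sol _ _ _ t0 (esym e3)); field; apply/andP.
  + by rewrite (sol _ _ _ r0 e1) (sol _ _ _ t0 (esym e3)); field; apply/andP.
  + by field; apply/andP.
  + by rewrite (sol _ _ _ r0 e2); field; apply/andP.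
- exists (x 0 o1 / (s * t)); apply/rowP; elim/ord4P; rewrite !mxE /=.
  + by rewrite (sol _ _ _ r0 (esym e1)); field; apply/andP.
  + by field; apply/andP.
  + by rewrite (sol _ _ _ r0 (esym e2)) (sol _ _ _ t0 e4); field; apply/andP.
  + by rewrite (sol _ _ _ t0 e4); field; apply/andP.
- exists (x 0 o3 / (s * v)); apply/rowP; elim/ord4P; rewrite !mxE /=.
  + by rewrite (sol _ _ _ r0 (esym e1)) (sol _ _ _ t0 (esym e4)); field; apply/andP.
  + by rewrite (sol _ _ _ t0 (esym e4)); field; apply/andP.
  + by rewrite (sol _ _ _ r0 (esym e2)); field; apply/andP.
  + by field; apply/andP.
Qed.

Lemma row_free_rowsub p q k (g : 'I_p -> 'I_q) (X : 'M[F]_(q, k)) :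
  injective g -> row_free X -> row_free (rowsub g X).
Proof.
move=> injg /row_freeP[Y XY]; apply/row_freeP; exists (Y *m (rowsub g 1%:M)^T).
rewrite mulmxA mul_rowsub_mx XY; apply/matrixP => i j; rewrite !mxE.
rewrite (bigD1 (g i)) //= !mxE eqxx mul1r big1 => [|h hi].
  by rewrite addr0 eq_sym (inj_eq injg).
by rewrite !mxE eq_sym (negPf hi) mul0r.
Qed.

Lemma cards3_le (T : finType) (a b c : T) : (#|[set a; b; c]| <= 3)%N.
Proof. by rewrite setUC !cardsU1 cards1; do 2!case: (_ \notin _). Qed.

Lemma mulslice_rank_gt6 (A B C : 'M[F]_(6, 4)) :
  ~ (forall x, mulslice x = B^T *m diag_mx (x *m A^T) *m C).
Proof.
move=> dec.
pose supp x := diag_support (x *m A^T).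
have rk x : (\rank (mulslice x) <= #|supp x|)%N by rewrite dec rank_diag_decomp.
have det0 x : (#|supp x| <= 3)%N -> det4 x = 0.
  move=> le3; apply/eqP; apply: contraTT le3 => /rank_mulslice_det rk4.
  by rewrite -ltnNge -[X in (X <= _)%N]rk4 rk.
have supp_gt1 x : x != 0 -> (1 < #|supp x|)%N.
  by move=> /rank_mulslice_gt1 /leq_trans; apply; apply: rk.
(* A nonzero [x] killed by all six functionals would have a zero slice. *)
have fullA : row_full A.
  rewrite -col_leq_rank -mxrank_tr row_leq_rank -kermx_eq0.
  apply: contraT => /rowV0Pn[x /sub_kermxP xA /supp_gt1].
  rewrite (_ : supp x = set0) ?cards0 //.
  by apply/setP => j; rewrite !inE xA mxE eqxx.
pose f := fullrankfun fullA; have injf : injective f by apply: fullrankfun_inj.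
(* The rows of [X] are the basis dual to the four functionals selected by [f]. *)
pose X : 'M[F]_4 := (invmx (rowsub f A))^T.
have uX : X \in unitmx by rewrite unitmx_tr unitmx_inv fullrowsub_unit.
have freeX : row_free X by rewrite row_free_unit.
pose M := X *m A^T.
have Mf i j : M i (f j) = (i == j)%:R.
  have : X *m (rowsub f A)^T = 1%:M.
    by rewrite -trmx_mul mulmxV ?trmx1 ?fullrowsub_unit.
  by move=> /matrixP/(_ i j); rewrite !mxE => <-; apply: eq_bigr => h _; rewrite !mxE.
have rowM i : row i X *m A^T = row i M by rewrite row_mul.
clearbody M.
have /cards2P[p [q [pq defC]]] : #|~: (f @: setT)| == 2%N.
  by rewrite -(eqn_add2l #|f @: setT|) cardsC card_imset // cardsT !card_ord.
have cover j : [|| j \in f @: setT, j == p | j == q].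
  by case: (boolP (j \in f @: setT)) => //=; rewrite -in_setC defC !inE.
have memE x j : (j \in supp x) = ((x *m A^T) 0 j != 0) by rewrite inE.
have supp_row i : supp (row i X) \subset [set f i; p; q].
  apply/subsetP => j; rewrite memE rowM mxE !inE => Mij.
  case/or3P: (cover j) Mij => [/imsetP[h _ ->]|->|->]; rewrite ?orbT //.
  by rewrite Mf; case: (eqVneq i h) => [->|]; rewrite ?eqxx.
have det_row i : det4 (row i X) = 0.
  apply: det0; apply: leq_trans (subset_leq_card (supp_row i)) _.
  exact: cards3_le.
have polar_id x : det4 x = 0 -> (x *m polar4 *m x^T) 0 0 = 0.
  move=> dx; rewrite !mxE sum4 !mxE !sum4 !mxE /=.
  transitivity (2 * det4 x); [by rewrite /det4; ring | by rewrite dx mulr0].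
(* Stated for [u] and [v] so that it serves both orders of [p] and [q]. *)
have half u v : (forall j, [|| j \in f @: setT, j == u | j == v]) ->
    (#|[set i | (M i u != 0)%R]| <= 2)%N.
  move=> cov; set K := [set i | _].
  pose g (i : 'I_#|K|) : 'I_4 := enum_val i.
  pose Y := rowsub g X.
  have freeY : row_free Y by apply: row_free_rowsub => //; apply: enum_val_inj.
  have Y0 : Y *m (polar4 *m Y^T) = 0.
    apply/matrixP => a b; rewrite [RHS]mxE mulmxA.
    have -> : (Y *m polar4 *m Y^T) a b = (row (g a) X *m polar4 *m (row (g b) X)^T) 0 0.
      rewrite !mxE; apply: eq_bigr => h _; rewrite !mxE; congr (_ * _).
      by apply: eq_bigr => h' _; rewrite !mxE.
    case: (eqVneq (g a) (g b)) => [->|neq]; first exact: polar_id.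
    have Ma : M (g a) u != 0 by have := enum_valP a; rewrite inE.
    have Mb : M (g b) u != 0 by have := enum_valP b; rewrite inE.
    (* The coefficients cancel the functional [u], leaving at most three active ones; the
       combination is singular and [det4B] yields orthogonality. *)
    have := det0 (M (g b) u *: row (g a) X - M (g a) u *: row (g b) X).
    rewrite det4B // => /(_ _)/eqP; rewrite mulf_eq0 oppr_eq0 mulf_eq0.
    rewrite (negPf Ma) (negPf Mb) /= => H; apply/eqP/H.
    have sub : supp (M (g b) u *: row (g a) X - M (g a) u *: row (g b) X)
        \subset [set f (g a); f (g b); v].
      apply/subsetP => j; rewrite memE mulmxBl -!scalemxAl !rowM !mxE !inE.
      case/or3P: (cov j) => [/imsetP[h _ ->]|/eqP->|->]; rewrite ?orbT //.
        rewrite !Mf; case: (eqVneq (g a) h) => [->|]; rewrite ?eqxx //.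
        by case: (eqVneq (g b) h) => [->|]; rewrite ?eqxx ?orbT // !mulr0 subrr eqxx.
      by rewrite mulrC subrr eqxx.
    apply: leq_trans (subset_leq_card sub) _.
    exact: cards3_le.
  have := mulmx0_rank_max Y0; rewrite (eqP freeY).
  have -> : \rank (polar4 *m Y^T) = #|K|.
    by rewrite -mxrank_tr trmx_mul trmxK mxrankMfree ?(eqP freeY) //
      row_free_unit unitmx_tr polar4_unit.
  by rewrite addnn -[4%N]/(2.*2)%N leq_double.
pose K := [set i | M i p != 0]; pose K' := [set i | M i q != 0].
have leK : (#|K| <= 2)%N by apply: (half p q).
have leK' : (#|K'| <= 2)%N.
  by apply: (half q p) => j; rewrite [(j == q) || _]orbC.
(* A basis vector killed by both [p] and [q] would have a single active functional, against
   [supp_gt1]. *)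
have KK' : K :|: K' = setT.
  apply/setP => i; rewrite !inE; apply: contraT; rewrite negb_or !negbK.
  move=> /andP[/eqP Mp /eqP Mq].
  have := supp_gt1 _ (row_free_row_neq0 i freeX).
  rewrite ltnNge -[X in (_ <= X)%N](cards1 (f i)) subset_leq_card //.
  apply/subsetP => j hj; have := subsetP (supp_row i) _ hj.
  rewrite !inE -orbA => /or3P[//| /eqP ej | /eqP ej]; move: hj.
    by rewrite memE rowM mxE ej Mp eqxx.
  by rewrite memE rowM mxE ej Mq eqxx.
(* Two sets of size at most 2 cover four indices, so they are disjoint pairs. *)
have cardKK' : #|K| = 2%N /\ #|K :&: K'| = 0%N.
  have := cardsUI K K'; rewrite KK' cardsT card_ord.
  by move: #|K| #|K'| #|_ :&: _| leK leK' => [|[|[|a]]] [|[|[|b]]] [|c].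
case: cardKK' => cardK /eqP; rewrite cards_eq0 => /eqP disjK.
have /cards2P[i [j [neq_ij defK]]] : #|K| == 2%N by rewrite cardK.
have tight h : h \in K -> M h p != 0 /\ (#|supp (row h X)| <= 2)%N.
  move=> hK; split; first by move: hK; rewrite inE.
  have Mq : M h q = 0.
    apply/eqP; apply: contraT => Mq; have : h \in K :&: K' by rewrite inE hK inE.
    by rewrite disjK inE.
  apply: leq_trans (subset_leq_card (_ : _ \subset [set f h; p])) _; last first.
    by rewrite cards2; case: (_ != _).
  apply/subsetP => l hl; have := subsetP (supp_row h) _ hl.
  rewrite !inE => /orP[//|/eqP el]; move: hl.
  by rewrite memE rowM mxE el Mq eqxx.
(* The support [{f h, p}] is no larger than the rank of the slice, so term [p] lies in its row
   space. *)
have tightC h : h \in K -> row p C != 0 /\ (row p C <= mulslice (row h X))%MS.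
  move=> /tight[Mp le2]; rewrite dec; apply: tight_decomp_row.
    by rewrite -dec (leq_trans le2) // rank_mulslice_gt1 // row_free_row_neq0.
  by rewrite rowM mxE.
have tightB h : h \in K -> row p B != 0 /\ (row p B <= (mulslice (row h X))^T)%MS.
  move=> /tight[Mp le2].
  have -> : (mulslice (row h X))^T = C^T *m diag_mx (row h X *m A^T) *m B.
    by rewrite dec !trmx_mul trmxK tr_diag_mx mulmxA.
  apply: tight_decomp_row; last by rewrite rowM mxE.
  rewrite -mxrank_tr !trmx_mul trmxK tr_diag_mx mulmxA -dec (leq_trans le2) //.
  by rewrite rank_mulslice_gt1 // row_free_row_neq0.
have iK : i \in K by rewrite defK !inE eqxx.
have jK : j \in K by rewrite defK !inE eqxx orbT.
have [[b0 bi] [_ bj]] := (tightB i iK, tightB j jK).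
have [[c0 ci] [_ cj]] := (tightC i iK, tightC j jK).
have [z hz] := mulslice_line b0 c0.
have [a xi] := hz _ (det_row i) bi ci; have [a' xj] := hz _ (det_row j) bj cj.
have : (a' *: delta_mx 0 i - a *: delta_mx 0 j) *m X == 0 :> 'rV_4.
  by rewrite mulmxBl -!scalemxAl -!rowE xi xj !scalerA mulrC subrr.
rewrite mulmx_free_eq0 // => /eqP/rowP/(_ j); rewrite !mxE !eqxx /=.
rewrite eq_sym (negPf neq_ij) mulr0 sub0r mulr1 => /eqP; rewrite oppr_eq0 => /eqP a0.
by have := row_free_row_neq0 i freeX; rewrite xi a0 scale0r eqxx.
Qed.

End MatrixMultiplicationRank.

(** * Unitary operators of each rank from 1 to 7 *)

Section Examples.

Variable R : realType.

Definition P0 : seq int := [:: 1; 0; 0; 0].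
Definition P1 : seq int := [:: 0; 0; 0; 1].
Definition E01 : seq int := [:: 0; 1; 0; 0].
Definition E10 : seq int := [:: 0; 0; 1; 0].
Definition sI : seq int := [:: 1; 0; 0; 1].
Definition sX : seq int := [:: 0; 1; 1; 0].
Definition sZ : seq int := [:: 1; 0; 0; -1].
Definition siY : seq int := [:: 0; 1; -1; 0].

Definition tensor1 : int_tensor := [:: (sI, sI, sI)].
Definition tensor2 : int_tensor := [:: (sI, P0, sI); (sI, P1, sX)].
(** The controlled operator [P0 (x) CNOT + P1 (x) X (x) Z]. *)
Definition tensor3 : int_tensor :=
  [:: (P0, P0, sI); (P0, P1, sX); (P1, sX, sZ)].
(** The identity on the first qubit, SWAP on the other two. *)
Definition tensor4 : int_tensor :=
  [:: (sI, P0, P0); (sI, P1, P1); (sI, E01, E10); (sI, E10, E01)].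
(* [P0 (x) SWAP + P1 (x) CNOT] *)
Definition tensor5 : int_tensor :=
  [:: (sI, P0, sI); (P0, [:: -1; 0; 0; 1], P1); (P1, P1, sX);
      (P0, E01, E10); (P0, E10, E01)].
(* [P0 (x) SWAP + P1 (x) (P0 (x) X + P1 (x) iY)] *)
Definition tensor6 : int_tensor :=
  [:: (P0, P0, P0); (P0, P1, P1); (P0, E01, E10); (P0, E10, E01);
      (P1, P0, sX); (P1, P1, siY)].

Definition id4 : seq (seq int) :=
  [:: [:: 1; 0; 0; 0]; [:: 0; 1; 0; 0]; [:: 0; 0; 1; 0]; [:: 0; 0; 0; 1]].

Definition swap4 (d : int) : seq (seq int) :=
  [:: [:: d; 0; 0; 0]; [:: 0; 0; d; 0]; [:: 0; d; 0; 0]; [:: 0; 0; 0; d]].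

Lemma schmidt_rank_tensor_op l :
  (forall k, has_tensor_decomp (tensor_op R l) k -> (size l <= k)%N) ->
  schmidt_rank_eq (tensor_op R l) (size l).
Proof.
move=> lower; split; first exact: tensor_op_decomp.
by move=> k ltk /lower; rewrite leqNgt ltk.
Qed.

Lemma rank1_example : exists U : op3 R, unitary U /\ schmidt_rank_eq U 1.
Proof.
exists (tensor_op R tensor1); split; first by apply: tensor_op_unitary; vm_compute.
apply: (@schmidt_rank_tensor_op tensor1) => k.
apply: (@pencil_checkP R tensor1 1 0 P0 P0 [:: [:: 1; 0; 0; 0]]
  [:: [:: 1]; [:: 0]; [:: 0]; [:: 0]] [::] [::] [::] 1).
by vm_compute.
Qed.

Lemma rank2_example : exists U : op3 R, unitary U /\ schmidt_rank_eq U 2.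
Proof.
exists (tensor_op R tensor2); split; first by apply: tensor_op_unitary; vm_compute.
apply: (@schmidt_rank_tensor_op tensor2) => k.
apply: (@pencil_checkP R tensor2 2 0 P0 P0
  [:: [:: 1; 0; 0; 0]; [:: 0; 0; 0; 1]]
  [:: [:: 1; 0]; [:: 0; 1]; [:: 0; 0]; [:: 0; 0]] [::] [::] [::] 1).
by vm_compute.
Qed.

Lemma rank3_example : exists U : op3 R, unitary U /\ schmidt_rank_eq U 3.
Proof.
exists (tensor_op R tensor3); split; first by apply: tensor_op_unitary; vm_compute.
apply: (@schmidt_rank_tensor_op tensor3) => k.
(* Pairing with [sI] has value 1 on both [P0] and [P1], so all three terms enter one slice. *)
apply: (@pencil_checkP R tensor3 3 0 sI sI
  [:: [:: 1; 1; 0; 0]; [:: 0; 0; 0; 2]; [:: 1; -1; 0; 0]]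
  [:: [:: 1; 0; 0]; [:: 0; 1; 0]; [:: 0; 0; 0]; [:: 0; 0; 1]]
  [::] [::] [::] 2).
by vm_compute.
Qed.

Lemma rank4_example : exists U : op3 R, unitary U /\ schmidt_rank_eq U 4.
Proof.
exists (tensor_op R tensor4); split; first by apply: tensor_op_unitary; vm_compute.
apply: (@schmidt_rank_tensor_op tensor4) => k.
apply: (@pencil_checkP R tensor4 4 0 P0 P0 (swap4 1) id4 [::] [::] [::] 1).
by vm_compute.
Qed.

Lemma rank5_example : exists U : op3 R, unitary U /\ schmidt_rank_eq U 5.
Proof.
exists (tensor_op R tensor5); split; first by apply: tensor_op_unitary; vm_compute.
apply: (@schmidt_rank_tensor_op tensor5) => k.
(* [W] adds the two off-diagonal rows: this gives zero on CNOT and [sX] on SWAP, which is the last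
   row of the CNOT slice. *)
apply: (@pencil_checkP R tensor5 4 1 P0 P1 (swap4 1) id4
  [:: [:: 0; 1; 1; 0]] [:: [:: 0; 0; 0; 1]]
  [:: [:: 0]; [:: 1]; [:: 0]; [:: 0]] 1).
by vm_compute.
Qed.

Lemma rank6_example : exists U : op3 R, unitary U /\ schmidt_rank_eq U 6.
Proof.
exists (tensor_op R tensor6); split; first by apply: tensor_op_unitary; vm_compute.
apply: (@schmidt_rank_tensor_op tensor6) => k.
(* The sum and difference of the off-diagonal rows vanish on [V] and give [sX] and [-siY] on SWAP,
   up to sign the nonzero rows of [V]. *)
apply: (@pencil_checkP R tensor6 4 2 P0 P1 (swap4 2) id4
  [:: [:: 0; 1; 1; 0]; [:: 0; 1; -1; 0]] [:: [:: 1; 0; 0; 0]; [:: 0; 0; 0; -1]]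
  [:: [:: 0; 0]; [:: 1; -1]; [:: 1; 1]; [:: 0; 0]] 2).
by vm_compute.
Qed.

(* Strassen's identity; the operator is the cyclic shift of the three qubits. *)
Definition tensor7 : int_tensor :=
  [:: (sI, sI, sI);
      ([:: 0; 0; 1; 1], P0, [:: 0; 1; 0; -1]);
      (P0, [:: 0; 1; 0; -1], [:: 0; 0; 1; 1]);
      (P1, [:: -1; 0; 1; 0], [:: 1; 1; 0; 0]);
      ([:: 1; 1; 0; 0], P1, [:: -1; 0; 1; 0]);
      ([:: -1; 0; 1; 0], [:: 1; 1; 0; 0], P1);
      ([:: 0; 1; 0; -1], [:: 0; 0; 1; 1], P0)].

(** Strassen's identity, checked coefficient by coefficient. *)
Lemma slice_tensor7 (x : 'rV[R[i]]_4) :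
  slice (\matrix_(i, j) x 0 (inord (i * 2 + j))) (tensor_op R tensor7) = mulslice x.
Proof.
apply/matrixP => q s; rewrite slice_tensor_opE !big_ord_recl !big_ord0.
have coefE p (q' s' : 'I_4) : (p < 4)%N -> tensor_coef tensor7 p q' s' =
    if ((q' %% 2 == s' %/ 2) && (p == s' %% 2 * 2 + q' %/ 2))%N then 1 else 0.
  by elim/ord4P: q'; elim/ord4P: s'; case: p => [|[|[|[|]]]].
rewrite !coefE // !mxE; elim/ord4P: q; elim/ord4P: s => /=;
by rewrite ?(mulr0, mulr1, addr0, add0r) ?mulr1z ?mulr1.
Qed.

Lemma rank7_example : exists U : op3 R, unitary U /\ schmidt_rank_eq U 7.
Proof.
exists (tensor_op R tensor7); split; first by apply: tensor_op_unitary; vm_compute.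
apply: (@schmidt_rank_tensor_op tensor7) => k; rewrite leqNgt => dec.
(* A shorter decomposition is padded with zero terms to exactly six. *)
apply/negP => ltk; have [A [B [D def]]] := has_tensor_decomp_le (ltk : (k <= 6)%N) dec.
apply: (@mulslice_rank_gt6 R[i] (rowvecs A) (rowvecs B) (rowvecs D)) => x.
rewrite -slice_tensor7 def slice_decomp; congr (_ *m diag_mx _ *m _).
apply/rowP => j; rewrite !mxE /dotmx !big_ord_recl !big_ord0 !mxE /= !addr0.
rewrite !addrA.
by congr (x 0 _ * A j _ _ + x 0 _ * A j _ _ + x 0 _ * A j _ _ + x 0 _ * A j _ _);
  apply: val_inj; rewrite //= inordK.
Qed.

End Examples.

Theorem theorem3 (R : realType) (r : nat) :
  (1 <= r <= 7)%N -> exists U : op3 R, unitary U /\ schmidt_rank_eq U r.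
Proof.
case: r => [|[|[|[|[|[|[|[|r]]]]]]]] // _.
- exact: rank1_example.
- exact: rank2_example.
- exact: rank3_example.
- exact: rank4_example.
- exact: rank5_example.
- exact: rank6_example.
- exact: rank7_example.
Qed.
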